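(* Let $n\geq 1$ and $\mathbb{B}=\{0,1\}$. A pseudo-Boolean function $f\colon\mathbb{B}^n\to\mathbb{R}$ is monotone if and only if it is a pseudo-polynomial function.
   Context: A pseudo-Boolean function is a map $f\colon\mathbb{B}^n\to\mathbb{R}$. For $k\in\{1,\dots,n\}$, $\mathbf{x}\in\mathbb{B}^n$ and $a\in\mathbb{B}$, $\mathbf{x}_k^a$ denotes the tuple obtained from $\mathbf{x}$ by replacing its $k$-th component by $a$. The partial derivative is $\Delta_kf(\mathbf{x})=f(\mathbf{x}_k^1)-f(\mathbf{x}_k^0)$. The function $f$ is isotone (resp. antitone) in its $k$-th variable if $\Delta_kf(\mathbf{x})\geq 0$ (resp. $\leq 0$) for all $\mathbf{x}\in\mathbb{B}^n$, monotone in its $k$-th variable if it is isotone or antitone in it, and $f$ is monotone if it is monotone in each of its variables. For reals $a<b$, a (lattice) polynomial function $p\colon[a,b]^n\to[a,b]$ is a function obtained from the projections and the constant functions with values in $[a,b]$ by finitely many applications of the pointwise operations $\min$ and $\max$. A pseudo-polynomial function is a function $f\colon\mathbb{B}^n\to\mathbb{R}$ of the form $f=p\circ(\varphi_1,\dots,\varphi_n)$, i.e. $f(\mathbf{x})=p(\varphi_1(x_1),\dots,\varphi_n(x_n))$, for some reals $a<b$, some lattice polynomial function $p\colon[a,b]^n\to[a,b]$ and some maps $\varphi_i\colon\mathbb{B}\to[a,b]$, $i=1,\dots,n$. *)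

(* Defs.v *)
From HB Require Import structures.
From mathcomp Require Import all_boot all_order all_algebra.
From mathcomp Require Import reals.

Set Implicit Arguments.
Unset Strict Implicit.
Unset Printing Implicit Defensive.

Import Order.TTheory GRing.Theory Num.Theory.
Local Open Scope ring_scope.

Section PseudoBoolean.
Variables (R : realType) (n : nat).
Implicit Types (f : {ffun 'I_n -> bool} -> R) (x : {ffun 'I_n -> bool}).

Definition update x (k : 'I_n) (a : bool) : {ffun 'I_n -> bool} :=
  [ffun i => if i == k then a else x i].

Definition partial_derivative (k : 'I_n) f x : R :=
  f (update x k true) - f (update x k false).

Definition isotone_in (k : 'I_n) f : Prop :=
  forall x, 0 <= partial_derivative k f x.

Definition antitone_in (k : 'I_n) f : Prop :=
  forall x, partial_derivative k f x <= 0.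

Definition monotone_in (k : 'I_n) f : Prop :=
  isotone_in k f \/ antitone_in k f.

Definition monotone f : Prop := forall k : 'I_n, monotone_in k f.

End PseudoBoolean.

Section ClosedInterval.
Variables (R : realType) (a b : R).

Record interval_type : Type :=
  IntervalElt { interval_val : R; _ : a <= interval_val <= b }.

HB.instance Definition _ := [isSub for interval_val].
HB.instance Definition _ := [Choice of interval_type by <:].
(* The order of R restricted to [a, b], so that Order.min and Order.max on
   interval_type are the lattice operations of the real interval. *)
HB.instance Definition _ :=
  [SubChoice_isSubOrder of interval_type by <: with ring_display].

End ClosedInterval.

Section PseudoPolynomial.
Variables (R : realType) (n : nat).

Inductive lattice_polynomial (a b : R) :
    ({ffun 'I_n -> interval_type a b} -> interval_type a b) -> Prop :=
| lattice_polynomial_proj (k : 'I_n) : lattice_polynomial (fun y => y k)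
| lattice_polynomial_const (c : interval_type a b) :
    lattice_polynomial (fun=> c)
| lattice_polynomial_min p q :
    lattice_polynomial p -> lattice_polynomial q ->
    lattice_polynomial (fun y => Order.min (p y) (q y))
| lattice_polynomial_max p q :
    lattice_polynomial p -> lattice_polynomial q ->
    lattice_polynomial (fun y => Order.max (p y) (q y)).

Definition pseudo_polynomial (f : {ffun 'I_n -> bool} -> R) : Prop :=
  exists (a b : R)
         (p : {ffun 'I_n -> interval_type a b} -> interval_type a b)
         (phi : 'I_n -> bool -> interval_type a b),
    [/\ a < b,
        lattice_polynomial p
      & forall x, f x = interval_val (p [ffun i => phi i (x i)])].

End PseudoPolynomial.

(* Main.v *)
Require Import Defs.
From mathcomp Require Import all_boot all_order all_algebra.
From mathcomp Require Import boolp reals.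

(** A lattice polynomial is nondecreasing in each argument, so composing it with
    [phi] gives a function that is isotone or antitone in [x_k] according to the
    order of [phi_k 0] and [phi_k 1].  Conversely, let [s k] be the value of
    [x_k] in the direction of which a monotone [f] grows, let [f] take values in
    [[a, b]], and let [phi_k] send [s k] to [b] and its negation to [a].  Then
    [f x] is the maximum over [z] of [min (f z) (min_(k | z k = s k) phi_k (x k))]:
    the term of [z] is [f z <= f x] when [z] lies below [x] in the order oriented
    by [s], and [a] otherwise, while [z = x] contributes [f x]. *)

Set Implicit Arguments.
Unset Strict Implicit.
Unset Printing Implicit Defensive.

Import Order.TTheory GRing.Theory Num.Theory.
Local Open Scope ring_scope.

Section LatticePolynomial.
Variables (R : realType) (n : nat) (a b : R).
Local Notation itv := (interval_type a b).
Local Notation poly := (@lattice_polynomial R n a b).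

Lemma lattice_polynomial_homo (p : {ffun 'I_n -> itv} -> itv) : poly p ->
  forall y y' : {ffun 'I_n -> itv}, (forall k, y k <= y' k) -> p y <= p y'.
Proof.
move=> pP y y' yy'; elim: pP => [k|c|q r _ qle _ rle|q r _ qle _ rle] //.
  by rewrite le_min !ge_min qle rle orbT.
by rewrite ge_max !le_max qle rle orbT.
Qed.

Lemma lattice_polynomial_bigmin (I : Type) (r : seq I) (P : pred I) c
    (F : I -> {ffun 'I_n -> itv} -> itv) : (forall i, poly (F i)) ->
  poly (fun y => \big[Order.min/c]_(i <- r | P i) F i y).
Proof.
move=> FP; elim: r => [|i r IHr].
  by under eq_fun do rewrite big_nil; exact: lattice_polynomial_const.
under eq_fun do rewrite big_cons.
by case: (P i) => //; exact: lattice_polynomial_min.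
Qed.

Lemma lattice_polynomial_bigmax (I : Type) (r : seq I) (P : pred I) c
    (F : I -> {ffun 'I_n -> itv} -> itv) : (forall i, poly (F i)) ->
  poly (fun y => \big[Order.max/c]_(i <- r | P i) F i y).
Proof.
move=> FP; elim: r => [|i r IHr].
  by under eq_fun do rewrite big_nil; exact: lattice_polynomial_const.
under eq_fun do rewrite big_cons.
by case: (P i) => //; exact: lattice_polynomial_max.
Qed.

End LatticePolynomial.

Section Monotone.
Variables (R : realType) (n : nat).
Implicit Types (f : {ffun 'I_n -> bool} -> R) (x z : {ffun 'I_n -> bool}).

Lemma pseudo_polynomial_monotone f : pseudo_polynomial f -> monotone f.
Proof.
move=> [a [b [p [phi [_ pP fE]]]]] k.
(* Keeping [c] and [d] arbitrary serves both orders of [phi k false] and [phi k true]. *)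
have f_le c d x : phi k c <= phi k d -> f (update x k c) <= f (update x k d).
  move=> phi_le; rewrite !fE; apply: (lattice_polynomial_homo pP) => i.
  by rewrite !ffunE; case: eqP => [->|].
case: (leP (phi k false) (phi k true)) => [|/ltW] phi_le; [left|right] => x.
  by rewrite subr_ge0 f_le.
by rewrite subr_le0 f_le.
Qed.

Lemma monotone_direction f : monotone f -> exists s : 'I_n -> bool,
  forall k x, f (update x k (~~ s k)) <= f (update x k (s k)).
Proof.
(* Isotonicity in [k] is decidable on the finite cube; where it fails, [f] is antitone in [k]. *)
move=> fmono; exists (fun k => [forall x, 0 <= partial_derivative k f x]) => k x.
case: forallP => [fk|Nfk]; first by rewrite -subr_ge0; exact: fk.
case: (fmono k) => [/Nfk //|fk]; rewrite -subr_le0; exact: fk.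
Qed.

(** Induction on the number of coordinates where [z] and [x] differ: at such a [k], [z k] is
    [~~ s k] and [x k] is [s k], so flipping [z k] does not decrease [f] and brings [z] closer to
    [x]. *)
Lemma le_direction f (s : 'I_n -> bool) :
    (forall k x, f (update x k (~~ s k)) <= f (update x k (s k))) ->
  forall z x, (forall k, z k = s k -> x k = s k) -> f z <= f x.
Proof.
move=> fs z x; have [m] := ubnP #|[pred k | z k != x k]|.
elim: m z => // m IHm z zm zx.
case: (pickP [pred k | z k != x k]) => [k /= zxk|zx0]; last first.
  by rewrite (_ : z = x) //; apply/ffunP => k; have /negbFE/eqP := zx0 k.
have zk : z k = ~~ s k.
  by move: (zx k) zxk; case: (z k) (s k) (x k) => [] [] [] //= ->.
have xk : x k = s k by move: zxk; rewrite zk; case: (s k) (x k) => [] [].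
have -> : z = update z k (~~ s k).
  by apply/ffunP => i; rewrite ffunE; case: eqP => [->|].
apply: le_trans (fs k z) _; apply: IHm => [|i]; last first.
  by rewrite ffunE; case: eqP => [->|_ /zx].
rewrite -ltnS; apply: leq_trans zm; rewrite ltnS; apply/proper_card/properP.
split; last by exists k; rewrite !inE // ffunE eqxx xk eqxx.
by apply/subsetP => i; rewrite !inE ffunE; case: (i =P k) => [->|//]; rewrite xk eqxx.
Qed.

Lemma monotone_pseudo_polynomial f : monotone f -> pseudo_polynomial f.
Proof.
move=> /monotone_direction[s /le_direction f_le].
(* The summand 1 keeps [- b < b] even when [f] is zero. *)
pose b := 1 + \sum_z `|f z|.
have b_gt0 : 0 < b by rewrite ltr_pwDl // sumr_ge0.
have f_itv z : - b <= f z <= b.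
  rewrite -ler_norml /b (bigD1 z) //= addrCA lerDl.
  by rewrite addr_ge0 // sumr_ge0.
have ab : - b < b by rewrite gtrN.
have a_itv : - b <= - b <= b by rewrite lexx ltW.
have b_itv : - b <= b <= b by rewrite lexx ltW.
pose A := IntervalElt a_itv; pose B := IntervalElt b_itv.
have A_le (u : interval_type (- b) b) : A <= u by have /andP[] := valP u.
have B_ge (u : interval_type (- b) b) : u <= B by have /andP[] := valP u.
pose F z := IntervalElt (f_itv z).
(* The defaults [A] and [B] are the bottom and top of the interval, hence neutral for max and
   min. *)
exists (- b), b, (fun y => \big[Order.max/A]_z
  Order.min (F z) (\big[Order.min/B]_(k | z k == s k) y k)),
  (fun k c => if c == s k then B else A); split => //.
  apply: lattice_polynomial_bigmax => z.
  apply: lattice_polynomial_min; first exact: lattice_polynomial_const.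
  by apply: lattice_polynomial_bigmin => k; exact: lattice_polynomial_proj.
move=> x; rewrite -[LHS]/(interval_val (F x)); congr interval_val.
apply/le_anti/andP; split.
  apply: le_trans (le_bigmax _ _ x); rewrite le_min lexx /=.
  by apply: le_bigmin => // k xk; rewrite ffunE xk B_ge.
apply: bigmax_le => // z _; rewrite ge_min.
(* A [k] found here puts [A] into the inner minimum; if there is none, [f_le] applies to [z] and
   [x]. *)
case: (pickP [pred k | (z k == s k) && (x k != s k)]) => [k /= /andP[zk xk]|zx].
  apply/orP; right; apply: le_trans (A_le (F x)).
  by apply: (bigmin_inf k) => //; rewrite ffunE (negbTE xk).
apply/orP; left; apply: f_le => k zk.
by have := zx k; rewrite /= zk eqxx => /negbFE/eqP.
Qed.

End Monotone.

Theorem theorem1 (R : realType) (n : nat) (hn : (0 < n)%N)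
    (f : {ffun 'I_n -> bool} -> R) :
  monotone f <-> pseudo_polynomial f.
Proof.
by split; [exact: monotone_pseudo_polynomial|exact: pseudo_polynomial_monotone].
Qed.
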